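(* Let $I_1:=I\subset\mathbb{Z}^d$ be a frequency set of finite cardinality $|I_1|<\infty$, and let $\delta\in\mathbb{R}$, $0<\delta<1$, and $c\in\mathbb{R}$, $c>1$, be fixed real numbers. For $j=1,2,\dots$ denote - $T_j:=|I_j|$, - $\lambda_j:=c(T_j-1)$, - $s_j:=\left\lceil\left(\frac{c}{c-1}\right)^2\frac{\ln T_j+\ln T_1-\ln\delta}{2}\right\rceil$, - $M_j$ the smallest prime in $P^{I_j}$ larger than $\lambda_j$, - $\boldsymbol z_j$ the best possible of $s_j$ randomly chosen generating vectors, - $I_{j+1}:=\{\boldsymbol k\in I_j:\ \exists\,\boldsymbol h\in I_j\setminus\{\boldsymbol k\}\text{ such that }\boldsymbol k\cdot\boldsymbol z_j\equiv\boldsymbol h\cdot\boldsymbol z_j\ (\mathrm{mod}\ M_j)\}$, and let $k:=\min\{\lceil s_1\ln T_1\rceil,\,T_1\}$. Then, with probability not less than $1-\frac{k\delta}{T_1}\ge 1-\delta$, the cardinality of the frequency set $I_{k+1}$ is zero, i.e. $\Lambda(\boldsymbol z_1,M_1,\dots,\boldsymbol z_k,M_k)$ is a reconstructing multiple rank-1 lattice for $I$.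
   Context: For a finite set $J\subset\mathbb{Z}^d$, $J_{\bmod M}:=\{\boldsymbol k\bmod M:\boldsymbol k\in J\}$ (componentwise residues in $\{0,\dots,M-1\}$), and $P^J:=\{M\in\mathbb{N}: M\text{ prime and }|J_{\bmod M}|=|J|\}$. For $\boldsymbol z\in\mathbb{Z}^d$, $M\in\mathbb{N}$, the rank-1 lattice with generating vector $\boldsymbol z$ and size $M$ is $\Lambda(\boldsymbol z,M)=\{\frac{j}{M}\boldsymbol z\bmod\boldsymbol 1: j=0,\dots,M-1\}\subset[0,1)^d$, and $\Lambda(\boldsymbol z_1,M_1,\dots,\boldsymbol z_k,M_k)=\bigcup_{\ell=1}^k\Lambda(\boldsymbol z_\ell,M_\ell)$ is a multiple rank-1 lattice. It is called reconstructing for $I$ if the matrix $(e^{2\pi i\boldsymbol k\cdot\boldsymbol x})$ with rows indexed by its nodes $\boldsymbol x$ and columns indexed by $\boldsymbol k\in I$ has full column rank, i.e. all trigonometric polynomials with frequencies in $I$ are uniquely determined by their values at the nodes. In step $j$ the $s_j$ generating vectors are chosen independently and uniformly at random from $[0,M_j-1]^d\cap\mathbb{Z}^d$. The ''best possible'' of them is one for which the number of $\boldsymbol k\in I_j$ with $\boldsymbol k\cdot\boldsymbol z\not\equiv\boldsymbol h\cdot\boldsymbol z\ (\mathrm{mod}\ M_j)$ for all $\boldsymbol h\in I_j\setminus\{\boldsymbol k\}$ is largest, i.e. one minimizing $|I_{j+1}|$. The construction is applied successively until $I_j=\emptyset$; if this happens for some $j\le k$, then all later sets are empty and the multiple rank-1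 lattice is the union of the lattices constructed up to that point.
   Formalization: The case |I| = 1 is excluded: there ln T_1 = 0 gives k = 0, so I_{k+1} = I_1 = I is nonempty with certainty, while the claim would give it cardinality zero with probability 1. *)

(* Defs.v *)
From HB Require Import structures.
From mathcomp Require Export all_boot all_order all_algebra.
From mathcomp Require Export finmap complex.
From mathcomp Require Export all_classical all_reals all_analysis.

Set Implicit Arguments.
Unset Strict Implicit.
Unset Printing Implicit Defensive.

Import Order.TTheory GRing.Theory Num.Theory.

Local Open Scope fset_scope.
Local Open Scope ring_scope.

Section FrequencySets.
Variable d : nat.
Implicit Types (J : {fset 'rV[int]_d}) (k h z : 'rV[int]_d) (M : nat).

Definition mod_vec M k : 'rV[int]_d := map_mx (fun a => (a %% M%:Z)%Z) k.

Definition mod_set J M : {fset 'rV[int]_d} := [fset mod_vec M k | k in J].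

Definition PJ J : pred nat := fun M => prime M && (#|` mod_set J M| == #|` J|).

Definition dotz k z : int := \sum_(i < d) k 0 i * z 0 i.

Definition aliased J M z : {fset 'rV[int]_d} :=
  [fset k in J | [exists h : J,
     (val h != k) && (dotz k z == dotz (val h) z %[mod M%:Z])%Z]].

Definition resolved J M z : {fset 'rV[int]_d} :=
  [fset k in J | [forall h : J,
     (val h != k) ==> (dotz k z != dotz (val h) z %[mod M%:Z])%Z]].

Definition box M z : Prop := forall i, 0 <= z 0 i <= M%:Z - 1.

Definition best_of J M (vs : seq 'rV[int]_d) z : Prop :=
  z \in vs /\
  forall z', z' \in vs -> (#|` resolved J M z'| <= #|` resolved J M z|)%N.

Lemma mod_set_inj J : exists B, forall p, (B < p)%N -> #|` mod_set J p| == #|` J|.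
Proof.
pose N k := (\sum_(i < d) `|k 0%R i|)%N.
exists (2 * \sum_(k <- enum_fset J) N k)%N => p ltBp.
have le_coef k i : k \in J ->
    (`|k 0%R i| <= \sum_(k <- enum_fset J) N k)%N.
  move=> kJ; rewrite (big_rem k) //=.
  by rewrite (leq_trans _ (leq_addr _ _)) // /N (bigD1 i) //= leq_addr.
rewrite card_in_imfset // => k h kJ hJ /rowP eq_kh; apply/rowP => i.
have := eq_kh i; rewrite !mxE => /eqP.
rewrite eqz_mod_dvd dvdzE absz_nat => p_dvd.
apply/eqP; rewrite -subr_eq0 -absz_eq0; apply/negPn/negP => nz.
have := dvdn_leq _ p_dvd; rewrite lt0n => /(_ nz); apply/negP.
rewrite -ltnNge (leq_ltn_trans _ ltBp) //.
rewrite (leq_trans (leqD_dist _ 0%R _)) // subr0 sub0r abszN mul2n -addnn.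
by rewrite leq_add // le_coef.
Qed.

End FrequencySets.

Section Construction.
Variables (R : realType) (d : nat) (c delta : R) (I : {fset 'rV[int]_d}).
Implicit Types (J : {fset 'rV[int]_d}).

Definition lambda J : R := c * (#|` J|%:R - 1).

(* The argument of the ceiling is positive whenever I and J are nonempty and
   0 < delta < 1, so the absolute value is only a cast from int to nat. *)
Definition num_samples J : nat :=
  `|Num.ceil ((c / (c - 1)) ^+ 2 *
              ((ln #|` J|%:R + ln #|` I|%:R - ln delta) / 2))|%N.

Lemma ex_lattice_size J : exists M, PJ J M && (lambda J < M%:R).
Proof.
have [B injB] := mod_set_inj J.
have [p lt_p pr_p] := prime_above (maxn B (Num.truncn `|lambda J|).+1).
move: lt_p; rewrite gtn_max => /andP[ltBp ltlp].
exists p; rewrite /PJ pr_p injB //= (le_lt_trans (ler_norm _)) //.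
have /andP[_ lt_tr] := truncn_itv (normr_ge0 (lambda J)).
by rewrite (lt_trans lt_tr) // ltr_nat.
Qed.

Definition lattice_size J : nat := ex_minn (ex_lattice_size J).

(* Indices are shifted by one: [freqs z j] is the set I_(j+1), and [z j] is the
   generating vector z_(j+1) used in the step from I_(j+1) to I_(j+2). *)
Fixpoint freqs (z : nat -> 'rV[int]_d) (j : nat) : {fset 'rV[int]_d} :=
  if j is j'.+1 then
    aliased (freqs z j') (lattice_size (freqs z j')) (z j')
  else I.

(* Degenerate case: if #|` I| = 1 then ln #|` I| = 0 and this is 0, so that no
   step is performed and the frequency set stays nonempty. *)
Definition num_steps : nat :=
  minn `|Num.ceil ((num_samples I)%:R * ln (#|` I|%:R) : R)|%N #|` I|.

(* [draws j w] is the list of the random candidates of a step and [z j w] the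
   vector selected among them. The number and the range of the candidates of a
   step depend on the outcome of the previous steps, hence "independently and
   uniformly at random" is a statement about the law of [draws j] conditional
   on the past: given any history, every list of [num_samples] vectors of the
   box has probability equal to the product of the uniform weights. Ties between
   best candidates may be broken in any (possibly random) way. Nothing is
   required of the steps that follow the exhaustion of the frequency set. *)
Definition history {disp} {Omega : measurableType disp}
    (draws : nat -> Omega -> seq 'rV[int]_d) (z : nat -> Omega -> 'rV[int]_d)
    (j : nat) (w0 : Omega) : set Omega :=
  [set w | forall i, (i < j)%N -> draws i w = draws i w0 /\ z i w = z i w0]%classic.

Record random_construction {disp} {Omega : measurableType disp}
    (P : probability Omega R)
    (draws : nat -> Omega -> seq 'rV[int]_d)
    (z : nat -> Omega -> 'rV[int]_d) : Prop := {
  draws_measurable : forall j vs,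
    measurable (draws j @^-1` [set vs])%classic;
  z_measurable : forall j v,
    measurable (z j @^-1` [set v])%classic;
  draws_range : forall j w (J := freqs (z ^~ w) j), J != fset0 ->
    size (draws j w) = num_samples J /\
    (forall v, v \in draws j w -> box (lattice_size J) v);
  draws_law : forall j w0 (J := freqs (z ^~ w0) j), J != fset0 ->
    forall vs : seq 'rV[int]_d,
    size vs = num_samples J ->
    (forall v, v \in vs -> box (lattice_size J) v) ->
    (P (history draws z j w0 `&` [set w | draws j w = vs])%classic =
     P (history draws z j w0) *
     (\prod_(i < num_samples J) ((lattice_size J)%:R ^+ d)^-1)%:E)%E;
  z_best : forall j w (J := freqs (z ^~ w) j), J != fset0 ->
    best_of J (lattice_size J) (draws j w) (z j w)
}.

End Construction.

Section Lattices.
Variables (R : realType) (d : nat).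

Definition frac_part (x : R) : R := x - (Num.floor x)%:~R.

Definition rank1_lattice (z : 'rV[int]_d) (M : nat) : {fset 'rV[R]_d} :=
  [fset \row_i frac_part (j%:R / M%:R * (z 0 i)%:~R) | j in iota 0 M].

Definition expi (t : R) : R[i] := Complex (cos t) (sin t).

Definition dotr (k : 'rV[int]_d) (x : 'rV[R]_d) : R :=
  \sum_(i < d) (k 0 i)%:~R * x 0 i.

Definition fourier_matrix (X : {fset 'rV[R]_d}) (I : {fset 'rV[int]_d}) :
    'M[R[i]]_(#|` X|, #|` I|) :=
  \matrix_(a, b) expi (2 * pi * dotr (nth 0 I b) (nth 0 X a)).

(* [row_full A]: the rank of A is its number of columns. *)
Definition reconstructing (X : {fset 'rV[R]_d}) (I : {fset 'rV[int]_d}) : Prop :=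
  row_full (fourier_matrix X I).

(* The union of the lattices constructed in the first k steps, steps with an
   already empty frequency set contributing nothing. *)
Definition multiple_lattice (c : R) (I : {fset 'rV[int]_d})
    (z : nat -> 'rV[int]_d) (k : nat) : {fset 'rV[R]_d} :=
  (\bigcup_(j <- iota 0 k | freqs c I z j != fset0)
     rank1_lattice (z j) (lattice_size c (freqs c I z j)))%fset.

End Lattices.

(* Main.v *)
(* One random generating vector aliases a given k in I_j with probability at
   most (T_j - 1)/M_j < 1/c: by a union bound over h it suffices to count the zeros in F_M^d
   of the nonzero linear form u |-> (k - h) . u. Hence s_j independent vectors
   all alias k with probability at most c^(-s_j), and
   c^-1 <= exp(-2 (1 - 1/c)^2) makes this at most delta / (T_1 T_j). Outside an
   event of probability delta / T_1, every k in I_j is therefore resolved by one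
   of the s_j candidates; by pigeonhole the best one resolves at least T_j / s_1
   frequencies, so that T_(j+1) <= T_j - 1 and T_(j+1) <= (1 - 1/s_1) T_j, and
   either bound empties the frequency set within k steps. The coefficients of a
   polynomial vanishing on the lattices are zero on I_1 \ I_2, then on
   I_2 \ I_3, and so on, since summing over the nodes of the j-th lattice
   isolates each coefficient that is not aliased within I_j. *)

Require Import Defs.
From mathcomp Require Import ring lra zify.

Set Implicit Arguments.
Unset Strict Implicit.
Unset Printing Implicit Defensive.

Import Order.TTheory GRing.Theory Num.Theory.

Local Open Scope fset_scope.
Local Open Scope ring_scope.

(** * Counting aliasing generating vectors *)

Lemma aliasedP d (J : {fset 'rV[int]_d}) M z k :
  reflect (k \in J /\ exists2 h, h \in J & h != k /\
             (dotz k z == dotz h z %[mod M%:Z])%Z)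
          (k \in aliased J M z).
Proof.
rewrite /aliased !inE /=; apply: (iffP andP) => [[kJ /existsP[h /andP[hk e]]]|].
  by split=> //; exists (val h); rewrite ?fsvalP.
move=> [kJ [h hJ [hk e]]]; split=> //; apply/existsP; exists [` hJ].
by rewrite /= hk.
Qed.

Lemma aliased_sub d (J : {fset 'rV[int]_d}) M z : aliased J M z `<=` J.
Proof. by apply/fsubsetP => k /aliasedP[]. Qed.

Lemma resolvedE d (J : {fset 'rV[int]_d}) M z :
  resolved J M z = J `\` aliased J M z.
Proof.
apply/fsetP => k; rewrite !inE /= andbC; case kJ: (k \in J) => /=; last by rewrite andbF.
rewrite !andbT; apply/forallP/existsPn => H h; have := H h.
  by rewrite negb_and implybE.
by rewrite negb_and implybE.
Qed.

Lemma card_aliased d (J : {fset 'rV[int]_d}) M z :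
  (#|` aliased J M z| + #|` resolved J M z|)%N = #|` J|.
Proof.
by rewrite resolvedE cardfsD (fsetIidPr (aliased_sub J M z)) subnKC //
   fsubset_leq_card // aliased_sub.
Qed.

Section AliasingCount.
Variables (p : nat) (d : nat).
Hypothesis p_pr : prime p.

Lemma eqz_mod_Fp (a b : int) :
  (a == b %[mod p%:Z])%Z = (a%:~R == b%:~R :> 'F_p).
Proof.
by rewrite eqz_mod_dvd (dvdz_pcharf (pchar_Fp p_pr)) rmorphB /= subr_eq0.
Qed.

(** Translate the kernel along a coordinate axis with [a 0 i != 0]: the map (t, u) |-> u + t e_i is
    injective on F_p times the kernel, since the form takes the value [a 0 i * t] there, and its
    image lies in F_p^d. *)
Lemma card_linear_form_ker (a : 'rV['F_p]_d) : a != 0 ->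
  (p * #|[set u : 'rV['F_p]_d | (\sum_i a 0 i * u 0 i == 0)%R]%SET| <= p ^ d)%N.
Proof.
case/rV0Pn => i ai0; set A := [set u | _]%SET.
pose f (tu : 'F_p * 'rV['F_p]_d) : 'rV['F_p]_d := tu.2 + tu.1 *: delta_mx 0 i.
have lin t u : u \in A -> \sum_j a 0 j * f (t, u) 0 j = a 0 i * t.
  rewrite inE /f /= => /eqP u0.
  under eq_bigr do rewrite !mxE mulrDr.
  rewrite big_split /= u0 add0r (bigD1 i) //= !eqxx mulr1 big1 ?addr0 // => j ji.
  by rewrite (negPf ji) mulr0 mulr0.
rewrite -{1}(card_Fp p_pr) -cardsT -cardsX -(card_in_imset (f := f)); last first.
  move=> [t u] [t' u'] /setXP[_ uA] /setXP[_ u'A] /= e.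
  have tt' : t = t'.
    by apply: (mulfI ai0); rewrite -(lin t u) // -(lin t' u') // e.
  by move: e; rewrite /f /= tt' => /addIr ->.
by rewrite (leq_trans (max_card _)) // card_mx card_Fp // mul1n.
Qed.

(** These representatives exhaust [box p], so candidate vectors can be counted in a finite type. *)
Definition lift_Fp (u : 'rV['F_p]_d) : 'rV[int]_d :=
  map_mx (fun a : 'F_p => (a : nat)%:Z) u.

Lemma lift_FpK u : map_mx intr (lift_Fp u) = u.
Proof.
by apply/rowP => i; rewrite !mxE /= -[RHS]natr_Zp.
Qed.

Lemma box_lift_Fp u : box p (lift_Fp u).
Proof.
move=> i; rewrite !mxE /=; have := ltn_ord (u 0 i).
by rewrite [X in (_ < X)%N]Fp_cast //; lia.
Qed.

Lemma box_lift_FpP v : box p v -> {u | v = lift_Fp u}.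
Proof.
move=> bv; exists (map_mx intr v); apply/rowP => i; rewrite !mxE.
have /andP[v0 vp] := bv i; case: (v 0 i) v0 vp => // n _ np.
rewrite /= val_Fp_nat // modn_small //.
by move: np; lia.
Qed.

Lemma box_seq_lift_Fp (us : seq 'rV[int]_d) s : size us = s ->
  (forall v, v \in us -> box p v) ->
  exists t : {ffun 'I_s -> 'rV['F_p]_d}, us = [seq lift_Fp (t i) | i <- enum 'I_s].
Proof.
move=> sz bx; exists [ffun i => map_mx intr (nth 0 us (i : 'I_s))].
apply: (@eq_from_nth _ 0); first by rewrite size_map size_enum_ord.
rewrite sz => i lt_is; rewrite (nth_map (Ordinal lt_is)) ?size_enum_ord //.
rewrite ffunE nth_enum_ord //.
have [u e] : {u : 'rV['F_p]_d | nth 0 us i = lift_Fp u}.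
  by apply: box_lift_FpP; apply: bx; rewrite mem_nth // sz.
by rewrite e lift_FpK.
Qed.

Lemma dotz_Fp (k z : 'rV[int]_d) :
  (dotz k z)%:~R = \sum_i (k 0 i)%:~R * (z 0 i)%:~R :> 'F_p.
Proof.
by rewrite /dotz rmorph_sum; apply: eq_bigr => i _; rewrite rmorphM.
Qed.

(** If two distinct frequencies shared a residue, one of them could be removed from [J] without
    changing the residue set, which would then have fewer than |J| elements. *)
Lemma mod_vec_inj (J : {fset 'rV[int]_d}) : PJ J p ->
  {in J &, injective (mod_vec p)}.
Proof.
rewrite /PJ => /andP[_ /eqP e] k h kJ hJ ekh; apply/eqP/negPn/negP => nkh.
have sub : mod_set J p `<=` mod_set (J `\ k) p.
  apply/fsubsetP => _ /imfsetP[/= l lJ ->].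
  have [->|nlk] := eqVneq l k; last by rewrite in_imfset //= !inE nlk.
  by rewrite ekh in_imfset //= !inE eq_sym nkh.
have := leq_trans (fsubset_leq_card sub) (leq_imfset_card _ _ _).
by rewrite e /= -/(#|` J `\ k|) (cardfsD1 k J) kJ ltnn.
Qed.

(** Union bound over the other frequencies h: aliasing k with h means that the form k - h vanishes
    at u, and this form is nonzero over F_p because residues mod p separate [J]. *)
Lemma card_aliasing_vectors (J : {fset 'rV[int]_d}) k : PJ J p -> k \in J ->
  (p * #|[set u | k \in aliased J p (lift_Fp u)]%SET| <= #|` J|.-1 * p ^ d)%N.
Proof.
move=> PJp kJ.
pose A (h : 'rV[int]_d) :=
  [set u : 'rV['F_p]_d | (\sum_i ((k 0 i)%:~R - (h 0 i)%:~R) * u 0 i == 0)%R]%SET.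
have sub : [set u | k \in aliased J p (lift_Fp u)]%SET \subset
   \big[@finset.setU _/@finset.set0 _]_(h <- enum_fset (J `\ k)) A h.
  apply/fintype.subsetP => u; rewrite inE => /aliasedP[_ [h hJ [hk e]]].
  have hJk : h \in J `\ k by rewrite !inE hk.
  rewrite (big_rem h) //= inE; apply/orP; left; rewrite inE.
  move: e; rewrite eqz_mod_Fp !dotz_Fp -subr_eq0 -sumrB.
  congr (_ == _); apply: eq_bigr => i _; rewrite -mulrBl; congr (_ * _).
  by have /rowP/(_ i) := lift_FpK u; rewrite mxE.
have card_A h : h \in J `\ k -> (p * #|A h| <= p ^ d)%N.
  rewrite !inE => /andP[hk hJ].
  pose a := map_mx intr (k - h) : 'rV['F_p]_d.
  have := @card_linear_form_ker a.
  have -> : a != 0.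
    apply: contra hk; rewrite /a map_mxB subr_eq0 => /eqP e; apply/eqP.
    apply: (mod_vec_inj PJp) => //; apply/rowP => i; rewrite !mxE; apply/eqP.
    by rewrite eqz_mod_Fp; move/rowP/(_ i): e; rewrite !mxE => ->.
  move=> /(_ isT); congr (_ * _ <= _)%N; apply: eq_card => u; rewrite !inE.
  by congr (_ == _); apply: eq_bigr => i _; rewrite !mxE rmorphB.
have cJ : #|` J|.-1 = size (enum_fset (J `\ k)).
  by rewrite -/(#|` J `\ k|) (cardfsD1 k J) kJ.
rewrite (leq_trans (leq_mul (leqnn p) (subset_leq_card sub))) //.
rewrite cJ; have : {subset enum_fset (J `\ k) <= J `\ k} by move=> ?.
elim: (enum_fset _) => [|h s IH] hs /=; first by rewrite big_nil cards0 muln0.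
rewrite big_cons mulSn (leq_trans (leq_mul (leqnn p) (leq_card_setU _ _))) //.
rewrite mulnDr leq_add ?card_A ?hs ?mem_head ?IH // => x xs.
by apply: hs; rewrite inE xs orbT.
Qed.

End AliasingCount.

(** * The number of samples *)

(** The fourth power of q <= exp(-(1 - q)) leaves 2 (1 - q^4)^2 <= 4 (1 - q) to prove. Factoring 1 -
    q^4 = (1 - q)(1 + q)(1 + q^2) reduces this to a polynomial inequality. *)
Lemma expR_quartic (R : realType) (q : R) : 0 < q <= 1 ->
  q ^+ 4 <= expR (- (2 * (1 - q ^+ 4) ^+ 2)).
Proof.
move=> /andP[q0 q1].
have qe : q <= expR (- (1 - q)) by rewrite (le_trans _ (expR_ge1Dx _)) // ; lra.
have /le_trans-> // : q ^+ 4 <= expR (- (1 - q)) ^+ 4.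
  by apply: lerXn2r => //; rewrite nnegrE ?expR_ge0 // ltW.
rewrite -expRM_natl ler_expR.
have : (1 - q ^+ 4) * ((1 + q) * (1 + q ^+ 2)) <= 2.
  (* [r] is the quotient of [2 - (1 - q ^+ 4) * ((1 + q) * (1 + q ^+ 2))] by
     [(q - 2 / 3) ^+ 2], where 2 / 3 is close to the minimizer; the remainder is
     positive on [0, 1]. *)
  pose r := q ^+ 5 + 7 / 3 * q ^+ 4 + 11 / 3 * q ^+ 3 + 131 / 27 * q ^+ 2 +
    311 / 81 * q + 53 / 27.
  have r0 : 0 <= (q - 2 / 3) ^+ 2 * r.
    rewrite mulr_ge0 ?sqr_ge0 // /r.
    by repeat (apply: addr_ge0 || apply: mulr_ge0 || apply: exprn_ge0); lra.
  have -> : 2 = (1 - q ^+ 4) * ((1 + q) * (1 + q ^+ 2)) +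
     ((q - 2 / 3) ^+ 2 * r + 149 / 2187 - 65 / 729 * (q - 2 / 3)) by rewrite /r; field.
  lra.
move=> h.
have -> : 2 * (1 - q ^+ 4) ^+ 2 = (1 - q) * ((1 + q) * (1 + q ^+ 2)) * (2 * (1 - q ^+ 4)) by ring.
nra.
Qed.

(* Applying 1 + x <= exp x to c^-1 or to its square root is not sharp enough to give
   this for every c > 1; applied to its fourth root it is. *)
Lemma inv_le_expR (R : realType) (c : R) : 1 < c ->
  c^-1 <= expR (- (2 * (1 - c^-1) ^+ 2)).
Proof.
move=> c1; have c0 : 0 < c^-1 by rewrite invr_gt0; lra.
have c'1 : c^-1 <= 1 by rewrite invf_le1; lra.
pose q := Num.sqrt (Num.sqrt c^-1).
have q4 : q ^+ 4 = c^-1.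
  by rewrite (exprM q 2 2) /q !sqr_sqrtr ?sqrtr_ge0 // ltW.
rewrite -q4; apply: expR_quartic; rewrite /q !sqrtr_gt0 c0 /=.
by rewrite -sqrtr1 ler_sqrt ?ltr01 // -[leRHS]sqrtr1 ler_sqrt ?ltr01.
Qed.

Lemma ge_absz_ceil (R : realType) (x : R) : x <= `|Num.ceil x|%N%:R.
Proof.
by rewrite natr_absz (le_trans (ceil_ge x)) // ler_int ler_norm.
Qed.

Lemma absz_ceil_le (R : realType) (x y : R) : 0 <= x <= y ->
  (`|Num.ceil x| <= `|Num.ceil y|)%N.
Proof.
move=> /andP[x0 xy]; have := le_ceil xy.
have : 0 <= Num.ceil x by rewrite ceil_ge0; lra.
lia.
Qed.

Section NumSamples.
Variables (R : realType) (d : nat) (c delta : R) (I J : {fset 'rV[int]_d}).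
Hypotheses (c1 : 1 < c) (delta01 : 0 < delta < 1).
Hypotheses (I0 : (0 < #|` I|)%N) (J0 : (0 < #|` J|)%N).

(** With L = ln (T_j T_1 / delta), the factor (c / (c - 1))^2 / 2 in s_j cancels the rate 2 (1 -
    1/c)^2 of [inv_le_expR], so that c^(-s_j) <= exp(-L). The factor |J| anticipates the union bound
    over frequencies. *)
Lemma num_samples_tail :
  #|` J|%:R * c^-1 ^+ num_samples c delta I J <= delta / #|` I|%:R.
Proof.
have /andP[d0 d1] := delta01.
have I0' : 0 < #|` I|%:R :> R by rewrite ltr0n.
have J0' : 0 < #|` J|%:R :> R by rewrite ltr0n.
rewrite mulrC -ler_pdivlMr //; set s := num_samples _ _ _ _.
pose L : R := ln #|` J|%:R + ln #|` I|%:R - ln delta.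
have -> : delta / #|` I|%:R / #|` J|%:R = expR (- L).
  rewrite /L opprB expRD expRN expRD !lnK ?posrE //.
  by rewrite invfM mulrA mulrAC.
have c0 : 0 < c := lt_trans ltr01 c1.
have c'0 : 0 < c^-1 by rewrite invr_gt0.
apply: (@le_trans _ _ (expR (- (2 * (1 - c^-1) ^+ 2)) ^+ s)).
  by apply: lerXn2r; rewrite ?nnegrE ?expR_ge0 ?(ltW c'0) ?inv_le_expR.
rewrite -expRM_natl ler_expR mulrN lerN2.
have := ge_absz_ceil ((c / (c - 1)) ^+ 2 * (L / 2)).
rewrite -/(num_samples c delta I J) -/s => hs.
have -> : L = (c / (c - 1)) ^+ 2 * (L / 2) * (2 * (1 - c^-1) ^+ 2).
  have cn0 : c != 0 by rewrite gt_eqF.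
  have c1' : c - 1 != 0 by rewrite gt_eqF // subr_gt0.
  by field; rewrite cn0 c1'.
by apply: ler_wpM2r => //; rewrite mulr_ge0 // sqr_ge0.
Qed.

Lemma num_samples_mono :
  (#|` J| <= #|` I|)%N -> (num_samples c delta I J <= num_samples c delta I I)%N.
Proof.
move=> JI; have /andP[d0 d1] := delta01.
have I0' : 0 < #|` I|%:R :> R by rewrite ltr0n.
have J0' : 0 < #|` J|%:R :> R by rewrite ltr0n.
have lJI : ln #|` J|%:R <= ln #|` I|%:R :> R by rewrite ler_ln ?posrE // ler_nat.
have lJ : 0 <= ln #|` J|%:R :> R by rewrite ln_ge0 // ler1n.
have ld : ln delta <= 0 by rewrite ln_le0 // ltW.
(* Nonnegativity of the smaller argument is required: the absolute value of the ceiling is not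
   monotone on negative numbers. *)
apply: absz_ceil_le; apply/andP; split.
  apply: mulr_ge0; [exact: sqr_ge0 | lra].
by apply: ler_wpM2l; [exact: sqr_ge0 | lra].
Qed.

End NumSamples.

(** If k = t_0, the unit decrements suffice. Otherwise a nonzero t_k would give 1 <= (1 - 1/s)^k t_0
    < exp(-k/s) t_0 <= 1, the last step because k >= s ln t_0. The start t_0 = 1 is excluded since
    ln 1 = 0 would make k = 0. *)
Lemma geometric_decay_eq0 (R : realType) (t : nat -> nat) (s : nat)
    (k := minn `|Num.ceil (s%:R * ln (t 0%N)%:R : R)|%N (t 0%N)) :
  (0 < s)%N -> t 0%N != 1%N ->
  (forall j, (j < k)%N -> t j.+1 <= (t j).-1)%N ->
  (forall j, (j < k)%N -> s * t j.+1 <= s.-1 * t j)%N ->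
  t k = 0%N.
Proof.
move=> s0 t1 dec geo.
have tk_sub j : (j <= k)%N -> (t j <= t 0 - j)%N.
  by elim: j => [|j IH] jk; [lia|have := IH (ltnW jk); have := dec j jk; lia].
have tk_geo j : (j <= k)%N -> (s ^ j * t j <= s.-1 ^ j * t 0)%N.
  elim: j => [|j IH] jk; first by rewrite !expn0.
  rewrite !expnSr -mulnA (leq_trans (leq_mul (leqnn _) (geo j jk))) //.
  by rewrite mulnCA [X in (_ <= X * _)%N]mulnC -mulnA leq_mul // IH // ltnW.
have [h|h] := leqP (t 0%N) `|Num.ceil (s%:R * ln (t 0%N)%:R : R)|%N.
  have kE : k = t 0%N by apply/minn_idPr.
  by have := tk_sub k (leqnn k); rewrite {2}kE; lia.
have kE : k = `|Num.ceil (s%:R * ln (t 0%N)%:R : R)|%N by apply/minn_idPl/ltnW.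
have t2 : (1 < t 0)%N by move: h t1; case: (t 0%N) => [|[]].
have lt0 : 0 < ln (t 0%N)%:R :> R by rewrite ln_gt0 // ltr1n.
apply/eqP; rewrite -leqn0 leqNgt; apply/negP => tk0.
(* Only for positive [k] does the strict inequality 1 - 1/s < exp(-1/s) survive taking powers. *)
have k0 : (0 < k)%N.
  rewrite kE absz_gt0 ceil_neq0; apply/orP; right.
  by rewrite mulr_gt0 // ltr0n.
have sR : 0 < s%:R :> R by rewrite ltr0n.
have q0 : 0 <= 1 - s%:R^-1 :> R by rewrite subr_ge0 invf_le1 // ler1n.
have : 1 <= (1 - s%:R^-1) ^+ k * (t 0%N)%:R :> R.
  have e : s.-1%:R = s%:R * (1 - s%:R^-1) :> R.
    by rewrite mulrBr divff ?gt_eqF // mulr1 -[in RHS](prednK s0) mulrSr addrK.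
  rewrite -(@ler_pM2l _ (s%:R ^+ k)) ?exprn_gt0 // mulr1 mulrA -exprMn -e.
  rewrite -!natrX -natrM ler_nat (leq_trans _ (tk_geo k (leqnn k))) //.
  by rewrite leq_pmulr.
apply/negP; rewrite -ltNge.
have -> : (t 0%N)%:R = expR (ln (t 0%N)%:R) :> R.
  by rewrite lnK // posrE ltr0n ltnW.
apply: (@lt_le_trans _ _ (expR (- s%:R^-1) ^+ k * expR (ln (t 0%N)%:R))).
  rewrite ltr_pM2r ?expR_gt0 // ltrXn2r -?lt0n //.
  by apply: expR_gt1Dx; rewrite oppr_eq0 invr_eq0 gt_eqF.
rewrite -expRM_natl -expRD -[leRHS]expR0 ler_expR mulrN addrC subr_le0.
by rewrite ler_pdivlMr // mulrC kE ge_absz_ceil.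
Qed.

(** * Cardinality decay *)

Lemma eq_freqs (R : realType) d (c : R) (I : {fset 'rV[int]_d}) z z' j :
  (forall i, (i < j)%N -> z i = z' i) -> freqs c I z j = freqs c I z' j.
Proof.
elim: j => //= j IH e.
by rewrite e // IH // => i ij; rewrite e // ltnW.
Qed.

Lemma leq_card_cover (T U : choiceType) (F : U -> {fset T}) (b : nat) (vs : seq U)
    (S : {fset T}) :
  (forall k, k \in S -> exists2 v, v \in vs & k \in F v) ->
  (forall v, v \in vs -> #|` F v| <= b)%N -> (#|` S| <= size vs * b)%N.
Proof.
elim: vs S => [|v vs IH] S cover le_b.
  rewrite leqn0 cardfs_eq0; apply/fset0Pn => -[k /cover[v]]; by rewrite in_nil.
rewrite mulSn -(cardfsID (F v) S) leq_add //.
  by rewrite (leq_trans _ (le_b v _)) ?mem_head // fsubset_leq_card // fsubsetIr.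
apply: IH => [k|u uvs]; last by apply: le_b; rewrite inE uvs orbT.
rewrite inE => /andP[kF /cover[u]]; rewrite inE => /orP[/eqP->|uvs ku].
  by rewrite (negPf kF).
by exists u.
Qed.

Definition covered d (J : {fset 'rV[int]_d}) M (vs : seq 'rV[int]_d) : bool :=
  [forall k : J, has (fun v => val k \notin aliased J M v) vs].

(** Pigeonhole: the resolved sets of the candidates cover [J], and none is larger than that of
    [z]. *)
Lemma card_resolved_best d (J : {fset 'rV[int]_d}) M vs z :
  best_of J M vs z -> covered J M vs ->
  (#|` J| <= size vs * #|` resolved J M z|)%N.
Proof.
move=> [_ best] /forallP cov; apply: (leq_card_cover (F := resolved J M)) => // k kJ.
have /hasP[v vvs kv] := cov [` kJ].
by exists v; rewrite // resolvedE inE kv.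
Qed.

Section Deterministic.
Variables (R : realType) (d : nat) (c delta : R) (I : {fset 'rV[int]_d}).
Variable z : nat -> 'rV[int]_d.
Hypotheses (c1 : 1 < c) (delta01 : 0 < delta < 1).

Lemma freqs_sub j : freqs c I z j `<=` I.
Proof.
elim: j => [|j IH] /=; first exact: fsubset_refl.
exact: fsubset_trans (aliased_sub _ _ _) IH.
Qed.

(** The deterministic half of the argument, for a single outcome: success of each of the first [k]
    steps empties the frequency set. *)
Lemma freqs_eq0 (draws : nat -> seq 'rV[int]_d)
    (k := num_steps c delta I) (J := freqs c I z) : #|` I| <> 1%N ->
  (forall j, J j != fset0 -> size (draws j) = num_samples c delta I (J j)) ->
  (forall j, J j != fset0 ->
    best_of (J j) (lattice_size c (J j)) (draws j) (z j)) ->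
  (forall j, (j < k)%N -> J j != fset0 ->
    covered (J j) (lattice_size c (J j)) (draws j)) ->
  #|` J k| = 0%N.
Proof.
move=> I1 sz best cov; have [I0|I0] := posnP #|` I|.
  by apply/eqP; rewrite -leqn0 (leq_trans (fsubset_leq_card (freqs_sub k))) ?I0.
have cE j : (#|` J j.+1| = #|` J j| - #|` resolved (J j) (lattice_size c (J j)) (z j)|)%N.
  by rewrite -(card_aliased (J j) (lattice_size c (J j)) (z j)) addnK.
have step j : (j < k)%N -> (#|` J j| <=
    num_samples c delta I I * #|` resolved (J j) (lattice_size c (J j)) (z j)|)%N.
  move=> jk; have [-> | J0] := eqVneq (J j) fset0; first by rewrite cardfs0.
  rewrite (leq_trans (card_resolved_best (best _ J0) (cov _ jk J0))) // sz // leq_mul //.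
  by apply: num_samples_mono; rewrite ?cardfs_gt0 ?fsubset_leq_card ?freqs_sub // -cardfs_gt0.
rewrite /k /num_steps; set s := num_samples _ _ _ _ in step *.
(* With s = 0 the tail bound for J = I would read T_1 <= delta / T_1, hence 1 <= T_1^2 <= delta. *)
have s0 : (0 < s)%N.
  rewrite lt0n; apply/eqP => s0.
  have I1R : 1 <= #|` I|%:R :> R by rewrite ler1n.
  have := num_samples_tail c1 delta01 I0 I0.
  rewrite -/s s0 expr0 mulr1 ler_pdivlMr ?ltr0n // => /(le_trans (mulr_ege1 I1R I1R)).
  by move=> d1; case/andP: delta01 => _; rewrite ltNge d1.
(* Both decay hypotheses come from T_j <= s r, where r is the number of resolved frequencies: r >= 1
   unless T_j = 0, and s (T_j - r) <= (s - 1) T_j. *)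
apply: (@geometric_decay_eq0 R (fun j => #|` J j|) s) => // [|j jk|j jk].
- exact/eqP.
- have := step j jk; rewrite cE; nia.
- have := step j jk; rewrite cE mulnBr -subn1 mulnBl mul1n; nia.
Qed.

End Deterministic.

(** * Reconstruction *)

Section Expi.
Variable R : realType.
Implicit Types t u : R.

Lemma expiD t u : expi (t + u) = expi t * expi u.
Proof. by apply/eqP; rewrite eq_complex /= cosD sinD eqxx /= addrC. Qed.

Lemma expi0 : expi (0 : R) = 1.
Proof. by apply/eqP; rewrite eq_complex /= cos0 sin0 !eqxx. Qed.

Lemma expiN t : expi (- t) * expi t = 1.
Proof. by rewrite -expiD addNr expi0. Qed.

Lemma expiMn t n : expi (t *+ n) = expi t ^+ n.
Proof. by elim: n => [|n IH]; rewrite ?expi0 // mulrS expiD IH exprS. Qed.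

Lemma expi_2piz (m : int) : expi (2 * pi * m%:~R : R) = 1.
Proof.
have e : expi (2 * pi : R) = 1.
  by apply/eqP; rewrite eq_complex /= mulr_natl cos2pi sin2pi !eqxx.
have en n : expi (2 * pi * n%:R : R) = 1 by rewrite mulr_natr expiMn e expr1n.
case: m => n; first exact: en.
by rewrite NegzE rmorphN mulrN -[LHS]mulr1 -[X in _ * X](en n.+1) expiN.
Qed.

(** Modulo full turns the angle is 2y with 0 < y < pi, so its cosine 1 - 2 sin(y)^2 is less than
    1. *)
Lemma expi_neq1 (m : int) (M : nat) : (0 < M)%N -> ~~ (M%:Z %| m)%Z ->
  expi (2 * pi * (m%:~R / M%:R) : R) != 1.
Proof.
move=> M0 ndvd; have MR : 0 < M%:R :> R by rewrite ltr0n.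
pose r := (m %% M%:Z)%Z.
have r0 : 0 < r by rewrite lt_neqAle modz_ge0 ?andbT 1?eq_sym -?dvdz_mod0 //; lia.
have rM : r < M%:Z by rewrite ltz_pmod.
have -> : m%:~R / M%:R = (m %/ M%:Z)%Z%:~R + r%:~R / M%:R :> R.
  by rewrite {1}(divz_eq m M%:Z) rmorphD rmorphM /= mulrDl mulfK ?gt_eqF.
rewrite mulrDr expiD expi_2piz mul1r eq_complex negb_and /=; apply/orP; left.
set y := pi * (r%:~R / M%:R) : R.
have -> : 2 * pi * (r%:~R / M%:R) = y *+ 2 by rewrite mulr2n /y; ring.
have rR : 0 < r%:~R / M%:R :> R by rewrite divr_gt0 ?ltr0z.
have rR1 : r%:~R / M%:R < 1 :> R.
  by rewrite ltr_pdivrMr // mul1r -[M%:R]/(M%:Z%:~R) ltr_int.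
have : 0 < sin y.
  by apply: sin_gt0_pi; rewrite /y; have := pi_gt0 R; nra.
have := cos2Dsin2 y; rewrite cosD -expr2 -expr2 => e s0.
rewrite lt_eqF //; nra.
Qed.

End Expi.

Section Reconstruction.
Variables (R : realType) (d : nat).
Implicit Types (k h z : 'rV[int]_d).

Definition node z M j : 'rV[R]_d := \row_i frac_part (j%:R / M%:R * (z 0 i)%:~R).

(** Taking fractional parts changes the phase by an integer number of turns, so the values along the
    lattice are powers of one number. *)
Lemma expi_node k z M j :
  expi (2 * pi * dotr k (node z M j)) =
  expi (2 * pi * ((dotz k z)%:~R / M%:R) : R) ^+ j.
Proof.
pose n : int := - \sum_i k 0 i * Num.floor (j%:R / M%:R * (z 0 i)%:~R : R).
have -> : dotr k (node z M j) = (dotz k z)%:~R / M%:R *+ j + n%:~R.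
  rewrite /n rmorphN /= !rmorph_sum /= -mulr_natr -mulrA mulr_suml -sumrB.
  by apply: eq_bigr => i _; rewrite !mxE /frac_part !rmorphM /=; ring.
by rewrite mulrDr expiD expi_2piz mulr1 mulrnAr expiMn.
Qed.

(** A geometric sum whose ratio [w] satisfies w^M = 1 and w != 1. *)
Lemma lattice_sum0 k h z M : (0 < M)%N ->
  (dotz k z != dotz h z %[mod M%:Z])%Z ->
  \sum_(j < M) expi (2 * pi * dotr h (node z M j)) *
               expi (- (2 * pi * dotr k (node z M j))) = 0.
Proof.
move=> M0 kh; pose w : R[i] := expi (2 * pi * ((dotz h z - dotz k z)%:~R / M%:R)).
have -> : \sum_(j < M) expi (2 * pi * dotr h (node z M j)) *
               expi (- (2 * pi * dotr k (node z M j))) = \sum_(j < M) w ^+ j.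
  apply: eq_bigr => j _; rewrite expi_node.
  have -> : expi (2 * pi * ((dotz h z)%:~R / M%:R) : R) =
      w * expi (2 * pi * ((dotz k z)%:~R / M%:R)).
    by rewrite -expiD; congr expi; rewrite rmorphB /=; ring.
  by rewrite exprMn -expi_node -[LHS]mulrA [X in _ * X]mulrC expiN mulr1.
have w1 : w - 1 != 0.
  rewrite subr_eq0 expi_neq1 //; move: kh.
  by rewrite eq_sym eqz_mod_dvd.
apply: (mulfI w1); rewrite mulr0 -subrX1 -expiMn -mulrnAr.
have MR : M%:R != 0 :> R by rewrite pnatr_eq0 -lt0n.
by rewrite -[_ *+ M]mulr_natr divfK // expi_2piz subrr.
Qed.

(** Sum the vanishing values against the conjugate exponential of k. Frequencies outside [J] have
    zero coefficient, those of [J] other than k are orthogonal to it, and M v_b remains. The sum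
    runs over indices j < M, so coinciding nodes do no harm. *)
Lemma coef_eq0_of_lattice (I J : {fset 'rV[int]_d}) z M (v : 'I_(#|` I|) -> R[i]) :
  (0 < M)%N ->
  (forall j, (j < M)%N ->
     \sum_b v b * expi (2 * pi * dotr (nth 0 I b) (node z M j)) = 0) ->
  (forall b : 'I_(#|` I|), nth 0 I b \notin J -> v b = 0) ->
  forall b : 'I_(#|` I|), nth 0 I b \notin aliased J M z -> v b = 0.
Proof.
move=> M0 vX vJ b nal; have [bJ|] := boolP (nth 0 I b \in J); last exact: vJ.
set k := nth 0 I b in nal bJ.
have /eqP : \sum_(j < M) (\sum_b v b * expi (2 * pi * dotr (nth 0 I b) (node z M j)))
    * expi (- (2 * pi * dotr k (node z M j))) = 0.
  by rewrite big1 // => j _; rewrite vX ?mul0r.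
under eq_bigr do rewrite mulr_suml.
rewrite exchange_big /= (bigD1 b) //= [X in _ + X]big1 => [|b' b'b].
  under eq_bigr do rewrite -(mulrA (v b)) [X in v b * X]mulrC expiN mulr1.
  rewrite addr0 sumr_const card_ord -mulr_natr mulf_eq0 pnatr_eq0.
  by rewrite (gtn_eqF M0) orbF => /eqP.
under eq_bigr do rewrite -(mulrA (v b')).
rewrite -mulr_sumr; have [b'J|] := boolP (nth 0 I b' \in J); last first.
  by move/vJ->; rewrite mul0r.
rewrite lattice_sum0 ?mulr0 //; apply: contra nal => e; apply/aliasedP.
split=> //; exists (nth 0 I b') => //; split=> //.
by rewrite /k nth_uniq ?ltn_ord ?fset_uniq.
Qed.

Lemma reconstructingP (X : {fset 'rV[R]_d}) (I : {fset 'rV[int]_d}) :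
  (forall v : 'I_(#|` I|) -> R[i],
     (forall x, x \in X -> \sum_b v b * expi (2 * pi * dotr (nth 0 I b) x) = 0) ->
     forall b, v b = 0) ->
  reconstructing X I.
Proof.
move=> inj; rewrite /reconstructing /row_full -mxrank_tr.
apply: inj_row_free => v vA; apply/rowP => b; rewrite mxE.
apply: (inj (fun b => v 0 b)) => x xX.
have ix : (index x X < #|` X|)%N by rewrite index_mem.
have /rowP/(_ (Ordinal ix)) := vA; rewrite !mxE; apply: etrans.
by apply: eq_bigr => b' _; rewrite !mxE /= nth_index.
Qed.

Lemma reconstructing_multiple_lattice (c : R) (I : {fset 'rV[int]_d})
    (z : nat -> 'rV[int]_d) n :
  freqs c I z n = fset0 -> reconstructing (multiple_lattice c I z n) I.
Proof.
move=> In0; apply: reconstructingP => v vX.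
suff vJ j : (j <= n)%N -> forall b : 'I_(#|` I|), nth 0 I b \notin freqs c I z j -> v b = 0.
  by move=> b; apply: (vJ n) => //; rewrite In0 inE.
elim: j => [_ b|j IH jn b]; first by rewrite mem_nth ?ltn_ord.
(* An exhausted step adds no nodes, but then the induction hypothesis already covers every
   coefficient. *)
have [J0|J0] := eqVneq (freqs c I z j) fset0.
  by move=> _; apply: (IH (ltnW jn)); rewrite J0 inE.
have M0 : (0 < lattice_size c (freqs c I z j))%N.
  rewrite /lattice_size; case: ex_minnP => M /andP[/andP[/prime_gt0 //]].
apply: coef_eq0_of_lattice M0 _ (IH (ltnW jn)) b => i iM; apply: vX.
apply/bigfcupP; exists j; first by rewrite mem_iota jn J0.
by apply/imfsetP; exists i; rewrite //= mem_iota.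
Qed.

End Reconstruction.

(** * Probability of failure *)

(** The tuples that never resolve k are the functions into the set A_k of vectors aliasing k. There
    are |A_k|^s of them, and |A_k| / M^d <= (T - 1) / M <= 1/c by the choice of M; then sum over
    k. *)
Lemma card_uncovered (R : realType) (d : nat) (c : R) (J : {fset 'rV[int]_d}) (s : nat)
    (M := lattice_size c J) : 1 < c ->
  #|[set t : {ffun 'I_s -> 'rV['F_M]_d} |
      ~~ covered J M [seq lift_Fp (t i) | i <- enum 'I_s]]%SET|%:R
    * ((M%:R ^+ d)^-1) ^+ s <= #|` J|%:R * c^-1 ^+ s.
Proof.
move=> c1; have c0 : 0 < c := lt_trans ltr01 c1.
have [M_pr PJM cM] : [/\ prime M, PJ J M & c * (#|` J|%:R - 1) < M%:R].
  rewrite /M /lattice_size; case: ex_minnP => m /andP[PJm lm] _; split=> //.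
  by case/andP: PJm.
have M0 : 0 < M%:R :> R by rewrite ltr0n prime_gt0.
pose A (k : 'rV[int]_d) := [set u : 'rV['F_M]_d | k \in aliased J M (lift_Fp u)]%SET.
set B := [set t | _]%SET.
have cB : (#|B| <= \sum_(k <- enum_fset J) #|A k| ^ s)%N.
  have sub : B \subset
      \big[@finset.setU _/@finset.set0 _]_(k <- enum_fset J)
        [set t : {ffun 'I_s -> 'rV['F_M]_d} | t \in ffun_on (A k)]%SET.
    apply/fintype.subsetP => t; rewrite inE => /forallPn[k /hasPn ak].
    rewrite (big_rem (val k)) /=; last exact: fsvalP.
    rewrite inE; apply/orP; left; rewrite inE; apply/ffun_onP => i.
    have tin : lift_Fp (t i) \in [seq lift_Fp (t i) | i <- enum 'I_s].
      by apply: (map_f (fun i => lift_Fp (t i))); rewrite mem_enum.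
    by rewrite inE; have := ak _ tin; rewrite negbK.
  rewrite (leq_trans (subset_leq_card sub)) //.
  elim: (enum_fset J) => [|k r IH]; first by rewrite !big_nil cards0.
  rewrite !big_cons (leq_trans (leq_card_setU _ _)) // leq_add //.
  by rewrite cardsE card_ffun_on card_ord.
have Md0 : 0 < M%:R ^+ d :> R by rewrite exprn_gt0.
rewrite (le_trans (y := \sum_(k <- enum_fset J) (#|A k|%:R / M%:R ^+ d) ^+ s)) //.
  have /le_trans-> // : #|B|%:R * (M%:R ^+ d)^-1 ^+ s <=
      (\sum_(k <- enum_fset J) #|A k| ^ s)%N%:R * (M%:R ^+ d)^-1 ^+ s :> R.
    by rewrite ler_wpM2r ?ler_nat // exprn_ge0 // invr_ge0 ltW.
  rewrite natr_sum mulr_suml ler_sum // => k _.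
  by rewrite natrX exprMn.
have -> : #|` J|%:R * c^-1 ^+ s = \sum_(k <- enum_fset J) c^-1 ^+ s.
  by rewrite big_const_seq count_predT iter_addr_0 mulr_natl.
rewrite big_seq_cond [leRHS]big_seq_cond ler_sum // => k /andP[kJ _].
apply: lerXn2r; rewrite ?nnegrE ?divr_ge0 ?invr_ge0 ?ler0n ?(ltW Md0) ?(ltW c0) //.
have J0 : (0 < #|` J|)%N by rewrite cardfs_gt0; apply/fset0Pn; exists k.
have : (M * #|A k|)%:R <= (#|` J|.-1 * M ^ d)%:R :> R.
  by rewrite ler_nat card_aliasing_vectors.
rewrite !natrM natrX -subn1 natrB // => le_A.
rewrite ler_pdivrMr // -(ler_pM2l M0) (le_trans le_A) // mulrA ler_pM2r //.
by rewrite ler_pdivlMr // mulrC ltW.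
Qed.

(** * Conditioning on a random variable with countably many values *)

Section CountableValued.
Local Open Scope classical_set_scope.
Context {disp : measure_display} {Omega : measurableType disp}.
Variables (T : countType) (f : Omega -> T).
Hypothesis mf : forall t, measurable (f @^-1` [set t]).

Lemma measurable_countable_preimage (B : set T) : measurable (f @^-1` B).
Proof.
have -> : f @^-1` B = \bigcup_n
    (if (choice.unpickle n : option T) is Some t then
       if `[< B t >] then f @^-1` [set t] else set0 else set0).
  apply/seteqP; split => [w Bw|w [n _]].
    by exists (choice.pickle (f w)) => //; rewrite choice.pickleK asboolT.
  by case: choice.unpickle => // t; case: asboolP => // Bt /= ->.
apply: bigcupT_measurable => n; case: choice.unpickle => // t.
by case: ifP.
Qed.

(** Law of total probability. Writing the conditional bound as a product lets null fibres be treated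
    like the others. *)
Lemma probability_le_fibres (R : realType) (P : probability Omega R)
    (B : set Omega) (a : R) : 0 <= a -> measurable B ->
  (forall t, (P (f @^-1` [set t] `&` B) <= a%:E * P (f @^-1` [set t]))%E) ->
  (P B <= a%:E)%E.
Proof.
move=> a0 mB PB; pose F n := f @^-1` [set t | choice.pickle t = n].
have mF n : measurable (F n) by exact: measurable_countable_preimage.
have tF : trivIset setT F.
  by move=> i j _ _ [w [/= <- <-]].
have FE n : (exists t, F n = f @^-1` [set t]) \/ F n = set0.
  have [[t tn]|nt] := pselect (exists t : T, choice.pickle t = n).
    left; exists t; apply/seteqP; split => w /=; last by move=> fw; rewrite /F /= fw.
    by rewrite -tn => /(pcan_inj choice.pickleK).
  by right; apply/seteqP; split => // w /= e; apply: nt; exists (f w).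
have cover : \bigcup_n F n = setT.
  by apply/seteqP; split => // w _; exists (choice.pickle (f w)).
have -> : B = \bigcup_n (F n `&` B) by rewrite -setI_bigcupl cover setTI.
rewrite measure_semi_bigcup; last 3 first.
- by move=> n; apply: measurableI.
- exact: trivIset_setIr.
- by apply: bigcupT_measurable => n; apply: measurableI.
rewrite -[leRHS]mule1 -(probability_setT P) -cover measure_semi_bigcup //; last first.
  exact: bigcupT_measurable.
rewrite -nneseriesZl //; apply: lee_nneseries => // n _.
by have [[t ->]|->] := FE n; [exact: PB | rewrite set0I measure0 mule0].
Qed.

End CountableValued.

Lemma measure_bigsetU_le d (T : ringOfSetsType d) (R : realFieldType)
    (mu : {measure set T -> \bar R}) (U : Type) (r : seq U) (Q : pred U) (A : U -> set T) :
  (forall u, measurable (A u)) ->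
  (mu (\big[setU/set0]_(u <- r | Q u) A u) <= \sum_(u <- r | Q u) mu (A u))%E.
Proof.
move=> mA; elim: r => [|u r IH]; first by rewrite !big_nil measure0.
rewrite !big_cons; case: ifP => // _.
apply: le_trans (measureU2 _ _ _) _ => //; first exact: bigsetU_measurable.
by rewrite leeD2l.
Qed.

Section Probability.
Local Open Scope classical_set_scope.
Context (R : realType) (disp : measure_display) (Omega : measurableType disp).
Variables (P : probability Omega R) (d : nat) (I : {fset 'rV[int]_d}) (c delta : R).
Variables (draws : nat -> Omega -> seq 'rV[int]_d) (z : nat -> Omega -> 'rV[int]_d).
Hypotheses (c1 : 1 < c) (delta01 : 0 < delta < 1).
Hypothesis rc : random_construction c delta I P draws z.

Local Notation J := (fun j w => freqs c I (z ^~ w) j).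
Local Notation M := (fun j w => lattice_size c (J j w)).

(** Records the history in a countable type, so that histories become the fibres of a
    countable-valued map. *)
Definition past (j : nat) (w : Omega) : seq (seq 'rV[int]_d * 'rV[int]_d) :=
  [seq (draws i w, z i w) | i <- iota 0 j].

Lemma history_past j w0 : history draws z j w0 = past j @^-1` [set past j w0].
Proof.
apply/seteqP; split => w /=.
  move=> h; apply/eq_in_map => i; rewrite mem_iota /= => /h[-> ->] //.
by move/eq_in_map => h i ij; have := h i; rewrite mem_iota /= => /(_ ij) [-> ->].
Qed.

Lemma measurable_history j w0 : measurable (history draws z j w0).
Proof.
have -> : history draws z j w0 = \bigcap_(i in [set i | (i < j)%N])
    (draws i @^-1` [set draws i w0] `&` z i @^-1` [set z i w0]).
  by apply/seteqP; split => w h i ij; have [] := h i ij.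
apply: bigcap_measurableType => i _; apply: measurableI.
  exact: (draws_measurable rc).
exact: (z_measurable rc).
Qed.

Lemma measurable_past j t : measurable (past j @^-1` [set t]).
Proof.
have [[w0 <-]|nt] := pselect (exists w0, past j w0 = t).
  by rewrite -history_past; exact: measurable_history.
suff -> : past j @^-1` [set t] = set0 by [].
by apply/seteqP; split => // w /= e; apply: nt; exists w.
Qed.

(** An event decided by the first [j] steps is a countable union of histories. *)
Lemma measurable_history_invariant j (B : set Omega) :
  (forall w w', history draws z j w w' -> B w -> B w') -> measurable B.
Proof.
move=> inv; have -> : B = past j @^-1` (past j @` B).
  apply/seteqP; split => [w Bw|w [w' Bw' e]]; first by exists w.
  by apply: inv Bw'; rewrite history_past /= e.
apply: measurable_countable_preimage; exact: measurable_past.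
Qed.

Lemma freqs_history j w w' : history draws z j w w' -> J j w' = J j w.
Proof. by move=> h; apply: eq_freqs => i ij; have [] := h i ij. Qed.

Definition failure j : set Omega :=
  [set w | J j w != fset0 /\ ~~ covered (J j w) (M j w) (draws j w)].

Lemma measurable_failure j : measurable (failure j).
Proof.
(* The index is [j.+1] because failure also depends on the draws of step [j] itself. *)
apply: (@measurable_history_invariant j.+1) => w w' h.
have h' : history draws z j w w' by move=> i ij; apply: h; rewrite ltnW.
rewrite /failure /= (freqs_history h').
by have [-> _] := h j (leqnn _).
Qed.

(** On a fixed history the set, the modulus and the sample count are constants, so failure is a
    finite union over uncovered tuples, each of conditional probability M^(-ds). *)
Lemma probability_failure j : (0 < #|` I|)%N -> (P (failure j) <= (delta / #|` I|%:R)%:E)%E.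
Proof.
move=> I0; have a0 : 0 <= delta / #|` I|%:R.
  by case/andP: delta01 => d0 _; rewrite divr_ge0 // ltW.
apply: (@probability_le_fibres _ _ _ (past j)) => //.
- exact: measurable_past.
- exact: measurable_failure.
move=> t; have [[w0 <-]|nt] := pselect (exists w0, past j w0 = t); last first.
  suff -> : past j @^-1` [set t] = set0 by rewrite set0I measure0 mule0.
  by apply/seteqP; split => // w /= e; apply: nt; exists w.
rewrite -history_past; set H := history _ _ _ _.
have mH : measurable H by exact: measurable_history.
have [J0|J0] := eqVneq (J j w0) fset0.
  suff -> : H `&` failure j = set0 by rewrite measure0 mule_ge0.
  by apply/seteqP; split => // w [/freqs_history e [+ _]]; rewrite e J0 eqxx.
set s := num_samples c delta I (J j w0).
pose vs (t : {ffun 'I_s -> 'rV['F_(M j w0)]_d}) := [seq lift_Fp (t i) | i <- enum 'I_s].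
have M_pr : prime (M j w0).
  by rewrite /lattice_size; case: ex_minnP => m /andP[/andP[]].
pose Q t := ~~ covered (J j w0) (M j w0) (vs t).
have mD u : measurable (H `&` [set w | draws j w = u]).
  by apply: measurableI => //; exact: (draws_measurable rc).
have sub : H `&` failure j `<=` \big[setU/set0]_(t | Q t) (H `&` [set w | draws j w = vs t]).
  move=> w [Hw [+ ncov]]; rewrite (freqs_history Hw) => Jw.
  have := draws_range rc (j := j) (w := w).
  rewrite /= (freqs_history Hw) => /(_ J0)[sz bx].
  rewrite (freqs_history Hw) in ncov.
  have [u e] := box_seq_lift_Fp M_pr sz bx.
  rewrite -bigcup_seq_cond; exists u; last by split.
  by rewrite /= mem_index_enum /Q /vs -e.
have mbad := measurable_failure j.
apply: (@le_trans _ _ (P (\big[setU/set0]_(t | Q t) (H `&` [set w | draws j w = vs t])))).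
  apply: le_measure => //; rewrite inE; first exact: measurableI.
  by apply: bigsetU_measurable.
apply: le_trans (measure_bigsetU_le _ _ _ _) _ => //.
have law u : P (H `&` [set w | draws j w = vs u]) =
    ((((M j w0)%:R ^+ d)^-1 ^+ s)%:E * P H)%E.
  rewrite muleC; have := draws_law rc (j := j) (w0 := w0) J0 (vs := vs u).
  rewrite prodr_const card_ord; apply.
    by rewrite size_map size_enum_ord.
  by move=> v /mapP[i _ ->]; exact: box_lift_Fp.
rewrite (eq_bigr (fun=> ((((M j w0)%:R ^+ d)^-1 ^+ s)%:E * P H)%E)); last by move=> u _; exact: law.
rewrite -ge0_sume_distrl //.
rewrite lee_wpmul2r // sumEFin lee_fin.
rewrite sumr_const -[leLHS]mulr_natl.
have J0' : (0 < #|` J j w0|)%N by rewrite cardfs_gt0.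
apply: le_trans (num_samples_tail c1 delta01 I0 J0').
apply: le_trans (card_uncovered (J j w0) s c1).
by rewrite cardsE.
Qed.

End Probability.

Theorem theorem4p1 (R : realType) (disp : measure_display)
    (Omega : measurableType disp) (P : probability Omega R)
    (d : nat) (I : {fset 'rV[int]_d}) (c delta : R)
    (draws : nat -> Omega -> seq 'rV[int]_d)
    (z : nat -> Omega -> 'rV[int]_d) :
  #|` I| <> 1%N ->
  0 < delta < 1 ->
  1 < c ->
  random_construction c delta I P draws z ->
  let T1 := #|` I| in
  let k := num_steps c delta I in
  let E := [set w | #|` freqs c I (z ^~ w) k| = 0%N]%classic in
  [/\ measurable E,
      ((1 - k%:R * delta / T1%:R)%:E <= P E)%E,
      1 - delta <= 1 - k%:R * delta / T1%:R &
      forall w, E w -> reconstructing (multiple_lattice c I (z ^~ w) k) I].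
Proof.
move=> I1 delta01 c1 rc T1 k E.
have /andP[d0 d1] := delta01.
have mE : measurable E.
  apply: (measurable_history_invariant rc (j := k)) => w w' h.
  by rewrite /E /= (freqs_history _ _ h).
have kT : (k <= T1)%N by exact: geq_minr.
split=> //; last first.
- by move=> w /eqP Ew; apply: reconstructing_multiple_lattice; apply/eqP; rewrite -cardfs_eq0.
(* For empty [I] the quotient by T_1 = 0 is 0 by convention; otherwise k <= T_1 gives the claim. *)
- rewrite lerD2l lerN2; have [T0|T0] := posnP T1.
    by rewrite T0 invr0 mulr0 ltW.
  by rewrite ler_pdivrMr ?ltr0n // mulrC ler_pM2l // ler_nat.
have [I0|I0] := posnP T1.
  have -> : E = setT.
    apply/seteqP; split => // w _; apply/eqP; rewrite -leqn0.
    by rewrite (leq_trans (fsubset_leq_card (freqs_sub _ _ _ _))) // -/T1 I0.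
  by rewrite probability_setT lee_fin I0 invr0 mulr0 subr0.
(* By contraposition of [freqs_eq0], a nonempty final set forces a failure in one of the first [k]
   steps; a union bound follows. *)
have subE : (~` E `<=` \big[setU/set0]_(j <- iota 0 k) failure I c draws z j)%classic.
  move=> w; apply: contra_notP => nbad.
  apply: (freqs_eq0 c1 delta01 (z := z ^~ w) (draws := draws ^~ w)) => //.
  - by move=> j /(draws_range rc)[].
  - by move=> j /(z_best rc).
  move=> j jk J0; apply/negPn/negP => ncov; apply: nbad.
  by rewrite -bigcup_seq; exists j; rewrite //= mem_iota.
have mbad := measurable_failure rc.
have PC : (P (~` E)%classic <= (k%:R * delta / T1%:R)%:E)%E.
  apply: (@le_trans _ _ (P (\big[setU/set0]_(j <- iota 0 k) failure I c draws z j)%classic)).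
    apply: le_measure => //; rewrite inE; first exact: measurableC.
    exact: bigsetU_measurable.
  apply: le_trans (measure_bigsetU_le _ _ _ _) _ => //.
  apply: (@le_trans _ _ (\sum_(j <- iota 0 k) (delta / T1%:R)%:E)%E).
    by apply: lee_sum => j _; exact: probability_failure.
  by rewrite sumEFin lee_fin big_const_seq count_predT size_iota iter_addr_0 -mulrA mulr_natl.
rewrite -[E]setCK probability_setC; last exact: measurableC.
by rewrite EFinB leeB.
Qed.
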